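(* Let $G$ be a pure $\kappa$-sparse gapset with conductor $c$ and genus $g$. Then $g + \kappa \leq c$.
   Context: $\mathbb{N}$ denotes the positive integers. A gapset is a finite set $G \subset \mathbb{N}$ such that whenever $z \in G$ and $z = x+y$ with $x,y \in \mathbb{N}$, then $x \in G$ or $y \in G$. The genus of $G$ is its cardinality $g$; we write $G = \{\ell_1 < \ell_2 < \cdots < \ell_g\}$. The conductor $c(G)$ is the least $s$ such that $s+n \notin G$ for all integers $n \geq 0$ (so $c(G) = \ell_g+1$ for $G \ne \emptyset$, and $c(\emptyset)=0$). For $g \geq 2$, $G$ is pure $\kappa$-sparse if $\ell_{i+1}-\ell_i \leq \kappa$ for all $i \in \{1,\dots,g-1\}$ and $\ell_{i+1}-\ell_i = \kappa$ for some $i$. By convention, $\emptyset$ is pure $0$-sparse and $\{1\}$ is pure $1$-sparse (and for no other value of the parameter). *)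

(* Defs.v *)
From mathcomp Require Import all_boot finmap boolp.

Set Implicit Arguments.
Unset Strict Implicit.
Unset Printing Implicit Defensive.

(* Positive integers are elements of nat that are different from 0. *)
Definition gapset (G : {fset nat}) : Prop :=
  0 \notin G /\
  forall x y z : nat, 0 < x -> 0 < y -> z \in G -> z = x + y ->
    x \in G \/ y \in G.

Definition genus (G : {fset nat}) : nat := #|` G|%fset.

(* Indices start at 0: [gap G i] is l_(i+1) for i < genus G. *)
Definition gap (G : {fset nat}) (i : nat) : nat :=
  nth 0 (sort leq (enum_fset G)) i.

Lemma conductor_ex (G : {fset nat}) :
  exists s : nat, `[< forall n : nat, s + n \notin G >].
Proof.
exists (\max_(x <- enum_fset G) x).+1; apply/asboolP => n; apply/negP => nG.
have := @leq_bigmax_seq _ (enum_fset G) predT id _ nG isT.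
by rewrite leqNgt addSn ltnS leq_addr.
Qed.

Definition conductor (G : {fset nat}) : nat := ex_minn (conductor_ex G).

(* The differences use truncated subtraction, which is harmless because
   [gap G] is increasing on the indices below [genus G]. *)
Definition pure_sparse (k : nat) (G : {fset nat}) : Prop :=
  [\/ G = fset0 /\ k = 0,
      G = [fset 1]%fset /\ k = 1
    | [/\ 2 <= genus G,
          forall i : nat, i.+1 < genus G -> gap G i.+1 - gap G i <= k
        & exists2 i : nat, i.+1 < genus G & gap G i.+1 - gap G i = k]].

(* Main.v *)
Require Import Defs.
From mathcomp Require Import all_boot finmap.

(* The numbers below the conductor comprise the gaps, the number 0 and the
   kappa - 1 numbers lying strictly between two consecutive gaps at distance
   kappa; hence g + 1 + (kappa - 1) <= c. *)

(** The inequality is a count inside the interval from 0 to c - 1. [genus_add_hole_le_conductor]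
    does the counting for any gap-free stretch ending at a gap; [gap_consecutive] supplies such a
    stretch of length kappa - 1. *)

Lemma lt_conductor (G : {fset nat}) (x : nat) : x \in G -> x < conductor G.
Proof.
rewrite /conductor; case: ex_minnP => s /boolp.asboolP sG _ xG.
by rewrite ltnNge; apply/negP => /subnKC sx; move: (sG (x - s)); rewrite sx xG.
Qed.

(** The lower end [a] may be a non-gap, so that [a = 0] is allowed. *)
Lemma genus_add_hole_le_conductor (G : {fset nat}) (a b : nat) :
  0 \notin G -> a < b -> b \in G ->
  (forall x, a < x < b -> x \notin G) -> genus G + (b - a) <= conductor G.
Proof.
move=> G0 ab bG hole; have bc := lt_conductor _ _ bG.
(* The number 0 makes up for the one lost in the open interval, so the length is exactly [b - a]; 0
   is not repeated, as the [iota] starts at [a.+1]. *)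
pose nongaps := 0 :: iota a.+1 (b - a.+1).
have nongapsP x : x \in nongaps = (x == 0) || (a < x < b).
  by rewrite inE mem_iota subnKC.
have -> : genus G + (b - a) = size (enum_fset G ++ nongaps).
  by rewrite size_cat /= size_iota -subSn.
rewrite -[conductor G](size_iota 0); apply: uniq_leq_size.
  rewrite cat_uniq fset_uniq andTb; apply/andP; split.
    by apply/hasPn => x; rewrite nongapsP => /predU1P[-> // | /hole].
  by rewrite /= mem_iota iota_uniq.
move=> x; rewrite mem_cat mem_iota nongapsP /= add0n.
case/or3P => [/lt_conductor // | /eqP -> | /andP[_ xb]].
  exact: leq_ltn_trans bc.
exact: ltn_trans bc.
Qed.

Lemma gap_in (G : {fset nat}) (i : nat) : i < genus G -> gap G i \in G.
Proof.
by move=> iG; rewrite -(mem_sort leq (enum_fset G)) mem_nth ?size_sort.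
Qed.

Lemma gap_onto (G : {fset nat}) (x : nat) : x \in G -> exists2 i, i < genus G & x = gap G i.
Proof.
rewrite -(mem_sort leq (enum_fset G)) => /(nthP 0)[i].
by rewrite size_sort => iG <-; exists i.
Qed.

Lemma gap_ltn (G : {fset nat}) (i j : nat) : i < j -> j < genus G -> gap G i < gap G j.
Proof.
move=> ij jG; apply: (sorted_ltn_nth ltn_trans) => //.
- by rewrite ltn_sorted_uniq_leq sort_uniq fset_uniq sort_sorted //; apply: leq_total.
- by rewrite inE size_sort (ltn_trans ij).
- by rewrite inE size_sort.
Qed.

(** Such an [x] in [G] would be some [gap G j], and strict monotonicity would force
    [i < j < i.+1]. *)
Lemma gap_consecutive (G : {fset nat}) (i x : nat) :
  i.+1 < genus G -> gap G i < x < gap G i.+1 -> x \notin G.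
Proof.
move=> iG /andP[ix xi]; apply/negP => /gap_onto[j jG xE]; subst x.
have [ij | ji | ij] := ltngtP i j; last by rewrite ij ltnn in ix.
- move: ij; rewrite leq_eqVlt => /predU1P[ij | ij]; first by rewrite ij ltnn in xi.
  by move: (ltn_trans xi (gap_ltn _ _ _ ij jG)); rewrite ltnn.
- by move: (ltn_trans ix (gap_ltn _ _ _ ji (ltnW iG))); rewrite ltnn.
Qed.

Theorem proposition3p4 (G : {fset nat}) (kappa : nat)
  (hG : gapset G) (hk : pure_sparse kappa G) :
  genus G + kappa <= conductor G.
Proof.
have [G0 _] := hG; case: hk => [[-> ->] | [GE ->] | [_ _ [i iG <-]]].
- by rewrite /genus cardfs0.
(* With a single gap, 0 stands in for the preceding gap: the hole is empty and [b - a] is 1. *)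
- apply: (genus_add_hole_le_conductor G 0 1) => //; first by rewrite GE inE.
  by case=> [|x].
- apply: genus_add_hole_le_conductor => //.
  + exact: gap_ltn.
  + exact: gap_in.
  + by move=> x; apply: gap_consecutive.
Qed.
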